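(* Let $G=(V,E,c)$ be a finite connected weighted graph with positive edge conductances and effective-resistance matrix $R$, and for nonempty $S\subseteq V$ put $\rho_G(S)=\det R[S]/\operatorname{cof}R[S]$. Let $\varnothing\neq A\subseteq B\subseteq V$. If $|B|\ge2$, let $u_B$ be the unique maximizer of $u^{\mathsf T}R[B]u$ over all $u\in\mathbb{R}^B$ with $\mathbf 1^{\mathsf T}u=1$; if $|B|=1$, let $u_B=1$. Then $$\rho_G(A)=\rho_G(B)\quad\Longleftrightarrow\quad u_B(v)=0\ \text{ for every } v\in B\setminus A.$$
   Context: $G=(V,E,c)$ is a finite connected undirected graph with edge conductances $c_e>0$; parallel edges are allowed, loops are omitted. With $N\in\mathbb{R}^{V\times E}$ the incidence matrix for an arbitrary orientation and $C=\operatorname{diag}(c_e)$, the weighted Laplacian is $L=NCN^{\mathsf T}$, and $L^+$ is its Moore--Penrose pseudoinverse. The effective resistance between $i,j\in V$ is $R_{ij}=(e_i-e_j)^{\mathsf T}L^+(e_i-e_j)$, and $R=(R_{ij})_{i,j\in V}$. For $S\subseteq V$, $R[S]$ is the principal submatrix of $R$ indexed by $S$. $\mathbf 1$ is the all-ones vector of the appropriate dimension. For a square matrix $M$, $\operatorname{cof}M=\sum_{i,j}(-1)^{i+j}\det M(i|j)$ is the sum of all cofactors, where $M(i|j)$ is $M$ with row $i$ and column $j$ deleted; for a $1\times1$ matrix it equals $1$. It is a fact that $\operatorname{cof}R[S]\ne0$ for every nonempty $S$, so $\rho_G(S)$ is well defined ($\rho_G(S)=0$ when $|S|=1$), and that for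 $|S|\ge2$ the maximum of $u^{\mathsf T}R[S]u$ over $u\in\mathbb{R}^S$ with $\mathbf 1^{\mathsf T}u=1$ equals $\rho_G(S)$ and is attained at the unique vector $u_S=\rho_G(S)R[S]^{-1}\mathbf 1$. *)

(* Defs.v *)
From HB Require Import structures.
From mathcomp Require Import all_boot all_order all_algebra.
From mathcomp Require Import reals.
From mathcomp Require classical_sets.

Set Implicit Arguments.
Unset Strict Implicit.
Unset Printing Implicit Defensive.

Import Order.TTheory GRing.Theory Num.Theory.
Local Open Scope ring_scope.

(* Matrices with rows or columns labelled by a finite type T (resp. a set S)
   are indexed by 'I_#|T| (resp. 'I_#|S|), through enum_val / enum_rank. *)

(* A finite connected undirected multigraph without loops.  Since E is an
   arbitrary finite type, parallel edges are allowed.  The order of the two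
   ends of an edge is an arbitrary orientation: it is used only to write down
   the incidence matrix, and adjacency ignores it. *)
Record wgraph (R : realType) (V E : finType) := WGraph {
  src : E -> V;
  tgt : E -> V;
  cond : E -> R;
  no_loop : forall e, src e != tgt e;
  cond_gt0 : forall e, 0 < cond e;
  graph_connected : forall x y : V,
    connect [rel u v | [exists e, ((src e == u) && (tgt e == v))
                               || ((src e == v) && (tgt e == u))]] x y
}.

Section MoorePenrose.
Variable R : realType.

Definition is_moore_penrose m n (A : 'M[R]_(m, n)) (X : 'M[R]_(n, m)) : Prop :=
  [/\ A *m X *m A = A, X *m A *m X = X,
      (A *m X)^T = A *m X & (X *m A)^T = X *m A].

Definition moore_penrose m n (A : 'M[R]_(m, n)) : 'M[R]_(n, m) :=
  classical_sets.xget 0 (is_moore_penrose A).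

Lemma is_moore_penrose_uniq m n (A : 'M[R]_(m, n)) X Y :
  is_moore_penrose A X -> is_moore_penrose A Y -> X = Y.
Proof.
case=> [x1 x2 x3 x4] [y1 y2 y3 y4].
have AXY : A *m X = A *m Y.
  rewrite -x3 -{1}y1 -(mulmxA (A *m Y)) trmx_mul x3 y3.
  by rewrite mulmxA x1.
have XAY : X *m A = Y *m A.
  rewrite -x4 -{1}y1 -(mulmxA A) mulmxA trmx_mul x4 y4.
  by rewrite -mulmxA (mulmxA A) x1.
by rewrite -x2 XAY -mulmxA AXY mulmxA y2.
Qed.

Lemma row_free_gram_unit m n (B : 'M[R]_(m, n)) :
  row_free B -> B *m B^T \in unitmx.
Proof.
move=> fB; rewrite -row_free_unit -kermx_eq0.
apply/eqP/row_matrixP => i; rewrite row0.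
set v := row i _.
have vBB : v *m (B *m B^T) = 0 by rewrite /v -row_mul mulmx_ker row0.
have vB0 : v *m B = 0.
  have : (v *m B) *m (v *m B)^T = 0.
    by rewrite trmx_mul mulmxA -(mulmxA v) vBB mul0mx.
  move=> /matrixP/(_ 0 0); rewrite !mxE => /eqP.
  rewrite psumr_eq0 => [|j _]; last by rewrite [X in _ * X]mxE -expr2 sqr_ge0.
  move=> /allP h; apply/matrixP => a j; rewrite ord1 [RHS]mxE.
  have := h j (mem_index_enum j); rewrite [X in _ * X]mxE mulf_eq0 orbb.
  by move/eqP.
by apply: (row_free_inj fB); rewrite vB0 mul0mx.
Qed.

Lemma full_rank_moore_penrose m r n (C : 'M[R]_(m, r)) (B : 'M[R]_(r, n)) :
  C^T *m C \in unitmx -> B *m B^T \in unitmx ->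
  is_moore_penrose (C *m B)
    (B^T *m invmx (B *m B^T) *m (invmx (C^T *m C) *m C^T)).
Proof.
move=> uC uB; set P := invmx (B *m B^T); set Q := invmx (C^T *m C).
have PT : P^T = P by rewrite trmx_inv trmx_mul trmxK.
have QT : Q^T = Q by rewrite trmx_inv trmx_mul trmxK.
have BP k (Z : 'M_(r, k)) : B *m (B^T *m (P *m Z)) = Z.
  by rewrite !mulmxA mulmxV // mul1mx.
have QC k (Z : 'M_(r, k)) : Q *m (C^T *m (C *m Z)) = Z.
  by rewrite (mulmxA C^T) mulmxA mulVmx // mul1mx.
have AX : C *m B *m (B^T *m P *m (Q *m C^T)) = C *m Q *m C^T.
  by rewrite -!mulmxA BP.
have XA : B^T *m P *m (Q *m C^T) *m (C *m B) = B^T *m P *m B.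
  by rewrite -!mulmxA QC.
split.
- by rewrite AX -!mulmxA QC.
- by rewrite XA -!mulmxA BP.
- by rewrite AX !trmx_mul trmxK QT mulmxA.
- by rewrite XA !trmx_mul trmxK PT mulmxA.
Qed.

Lemma moore_penroseP m n (A : 'M[R]_(m, n)) :
  is_moore_penrose A (moore_penrose A).
Proof.
suff [X AX] : exists X, is_moore_penrose A X.
  exact: (classical_sets.xgetPex 0 (ex_intro _ X AX)).
have uB : row_base A *m (row_base A)^T \in unitmx.
  exact/row_free_gram_unit/row_base_free.
have uC : (col_base A)^T *m col_base A \in unitmx.
  rewrite -{2}(trmxK (col_base A)); apply: row_free_gram_unit.
  by rewrite /row_free mxrank_tr -/(row_full _) col_base_full.
by have := full_rank_moore_penrose uC uB; rewrite mulmx_base; exists (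
  (row_base A)^T *m invmx (row_base A *m (row_base A)^T)
    *m (invmx ((col_base A)^T *m col_base A) *m (col_base A)^T)).
Qed.

End MoorePenrose.

Section EffectiveResistance.
Variables (R : realType) (V E : finType) (G : wgraph R V E).

Definition incidence_mx : 'M[R]_(#|V|, #|E|) :=
  \matrix_(i, k) ((enum_val i == src G (enum_val k))%:R
                - (enum_val i == tgt G (enum_val k))%:R).

Definition cond_mx : 'M[R]_#|E| := diag_mx (\row_k cond G (enum_val k)).

Definition laplacian : 'M[R]_#|V| :=
  incidence_mx *m cond_mx *m incidence_mx^T.

Definition basis_vec (x : V) : 'cV[R]_#|V| := delta_mx (enum_rank x) 0.

Definition eff_res (x y : V) : R :=
  ((basis_vec x - basis_vec y)^T *m moore_penrose laplacian
     *m (basis_vec x - basis_vec y)) 0 0.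

(* R[S], with the rows and columns in the order of enum_val; S = [set: V] gives
   the whole effective-resistance matrix. *)
Definition res_mx (S : {set V}) : 'M[R]_#|S| :=
  \matrix_(i, j) eff_res (enum_val i) (enum_val j).

Definition cof_sum n (M : 'M[R]_n) : R := \sum_i \sum_j cofactor M i j.

Definition rho (S : {set V}) : R := \det (res_mx S) / cof_sum (res_mx S).

Definition quad_form (S : {set V}) (u : 'cV[R]_#|S|) : R :=
  (u^T *m res_mx S *m u) 0 0.

Definition is_maximizer (S : {set V}) (u : 'cV[R]_#|S|) : Prop :=
  \sum_i u i 0 = 1 /\
  forall w : 'cV[R]_#|S|, \sum_i w i 0 = 1 -> quad_form w <= quad_form u.

(* For #|S| >= 2 a maximizer exists and is unique, so the default value 0 of
   xget is not used; the value for S empty is irrelevant. *)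
Definition opt_vec (S : {set V}) : 'cV[R]_#|S| :=
  if (2 <= #|S|)%N then classical_sets.xget 0 (@is_maximizer S)
  else const_mx 1.

End EffectiveResistance.

(* Main.v *)
Require Import Defs.
From mathcomp Require Import all_boot all_order all_algebra.
From mathcomp Require Import reals ring.
From mathcomp Require classical_sets.

Set Implicit Arguments.
Unset Strict Implicit.
Unset Printing Implicit Defensive.

Import Order.TTheory GRing.Theory Num.Theory.
Local Open Scope ring_scope.

(** Effective resistance satisfies
      R = d 1^T + 1 d^T - 2 L^+,
    with d the diagonal of L^+.  On vectors of zero total the first two terms
    contribute nothing to the quadratic form of R, and since the graph is
    connected L^+ is positive definite there; hence R, and each principal
    submatrix R[S], is strictly negative definite on vectors of zero total
    (res_mx_cond_neg_def).

    For a matrix M with this property, call u an equilibrium of level r when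
    1^T u = 1 and M u = r 1.  Any competitor w with 1^T w = 1 differs from u by
    a vector of zero total, so w^T M w = r + (w - u)^T M (w - u): the
    equilibrium is the unique maximizer and its level is the maximum
    (qform_le_equilibrium).  Cramer's rule identifies the level with
    det M / cof M (equilibrium_cramer).  Consequently u_S is an equilibrium of
    R[S] of level rho(S) for each nonempty S, singletons included
    (opt_vec_equilibrium).

    Now view vectors on A and on B as vectors on V, extended by zero.
    If rho(A) = rho(B), then u_A is a competitor on B attaining the maximum
    rho(B), so it is u_B by uniqueness, and u_B vanishes off A.
    Conversely, if u_B vanishes off A, the number u_A^T R u_B can be evaluated
    with either equilibrium equation (embed_equilibrium): u_A is supported in
    B and has total 1, which gives rho(B), while u_B is supported in A and has
    total 1, which gives rho(A). *)

(** * Equilibria of conditionally negative definite matrices *)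

Section ConditionallyNegativeDefinite.
Variable R : realType.

Definition total n (x : 'cV[R]_n) : R := \sum_i x i 0.

Definition qform n (M : 'M[R]_n) (x : 'cV[R]_n) : R := (x^T *m M *m x) 0 0.

Definition cond_neg_def n (M : 'M[R]_n) : Prop :=
  M^T = M /\ forall x : 'cV_n, total x = 0 -> x != 0 -> qform M x < 0.

Definition ones n : 'cV[R]_n := const_mx 1.

Lemma tr_mul_ones n (x : 'cV[R]_n) : x^T *m ones n = (total x)%:M.
Proof.
rewrite [LHS]mx11_scalar mxE; congr _%:M.
by apply: eq_bigr => i _; rewrite !mxE mulr1.
Qed.

Lemma ones_tr_mul n (x : 'cV[R]_n) : (ones n)^T *m x = (total x)%:M.
Proof. by rewrite -[LHS]trmxK trmx_mul trmxK tr_mul_ones tr_scalar_mx. Qed.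

Lemma totalD n (x y : 'cV[R]_n) : total (x + y) = total x + total y.
Proof. by rewrite /total -big_split; apply: eq_bigr => i _; rewrite !mxE. Qed.

Lemma totalB n (x y : 'cV[R]_n) : total (x - y) = total x - total y.
Proof. by rewrite /total -sumrB; apply: eq_bigr => i _; rewrite !mxE. Qed.

Lemma totalZ n a (x : 'cV[R]_n) : total (a *: x) = a * total x.
Proof. by rewrite /total mulr_sumr; apply: eq_bigr => i _; rewrite !mxE. Qed.

Lemma total_delta n (i : 'I_n) : total (delta_mx i 0) = 1.
Proof.
rewrite /total (bigD1 i) //= mxE !eqxx big1 ?addr0 // => j /negPf ji.
by rewrite mxE ji.
Qed.

Lemma tr_bilinear n (M : 'M[R]_n) (x y : 'cV[R]_n) :
  M^T = M -> (x^T *m M *m y)^T = y^T *m M *m x.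
Proof. by move=> MT; rewrite !trmx_mul trmxK MT mulmxA. Qed.

(** Testing an equilibrium against a vector sees only the total of that
    vector. *)
Lemma tr_mul_equilibrium n (M : 'M[R]_n) r (u x : 'cV[R]_n) :
  M *m u = r *: ones n -> x^T *m M *m u = (r * total x)%:M.
Proof.
by move=> Mu; rewrite -mulmxA Mu -scalemxAr tr_mul_ones scale_scalar_mx.
Qed.

(** The cross term of the expansion around u vanishes because w - u has zero
    total, so that u is a stationary point of the constrained form. *)
Lemma qform_equilibrium n (M : 'M[R]_n) r (u w : 'cV[R]_n) :
  M^T = M -> M *m u = r *: ones n -> total u = 1 -> total w = 1 ->
  qform M w = r + qform M (w - u).
Proof.
move=> MT Mu u1 w1; set x := w - u.
have x0 : total x = 0 by rewrite totalB u1 w1 subrr.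
have -> : w = u + x by rewrite /x addrC subrK.
clearbody x.
have uMx : u^T *m M *m x = 0.
  apply: trmx_inj; rewrite tr_bilinear // (tr_mul_equilibrium _ Mu).
  by rewrite x0 mulr0 raddf0 trmx0.
rewrite /qform [(u + x)^T]linearD /= !mulmxDl !mulmxDr uMx.
rewrite !(tr_mul_equilibrium _ Mu).
by rewrite u1 x0 mulr1 mulr0 addr0 raddf0 add0r mxE [X in X + _]mxE eqxx.
Qed.

Lemma qform_le_equilibrium n (M : 'M[R]_n) r (u w : 'cV[R]_n) :
  cond_neg_def M -> M *m u = r *: ones n -> total u = 1 -> total w = 1 ->
  qform M w <= r ?= iff (w == u).
Proof.
move=> [MT Mneg] Mu u1 w1; rewrite (qform_equilibrium MT Mu u1 w1).
have [->|wu] := eqVneq w u.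
  by rewrite subrr /qform mulmx0 mxE addr0; apply/leifP.
apply/leifP; rewrite gtrDl; apply: Mneg; first by rewrite totalB u1 w1 subrr.
by rewrite subr_eq0.
Qed.

(** A kernel vector cannot have zero total, so after rescaling it would be an
    equilibrium of level 0, and 0 would bound the form at every vector of
    total 1. *)
Lemma cond_neg_def_unitmx n (M : 'M[R]_n) w :
  cond_neg_def M -> total w = 1 -> 0 < qform M w -> M \in unitmx.
Proof.
move=> cM w1 w_gt0; have [MT Mneg] := cM.
rewrite -row_free_unit -kermx_eq0; apply/eqP/row_matrixP => i; rewrite row0.
apply/eqP/negPn/negP; set v := row i _ => v_neq0.
have Mv : M *m v^T = 0.
  by rewrite -{1}MT -trmx_mul /v -row_mul mulmx_ker row0 trmx0.
have v_tot : total v^T != 0.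
  apply/eqP => v0; suff : qform M v^T < 0.
    by rewrite /qform -mulmxA Mv mulmx0 mxE ltxx.
  by apply: Mneg => //; rewrite trmx_eq0.
have Mu : M *m ((total v^T)^-1 *: v^T) = 0 *: ones n.
  by rewrite -scalemxAr Mv scaler0 scale0r.
have u1 : total ((total v^T)^-1 *: v^T) = 1 by rewrite totalZ mulVf.
by have := (qform_le_equilibrium cM Mu u1 w1).1; rewrite leNgt w_gt0.
Qed.

Lemma qformZ n (M : 'M[R]_n) a x : qform M (a *: x) = a ^+ 2 * qform M x.
Proof.
rewrite /qform [(a *: x)^T]linearZ /= -!scalemxAl -scalemxAr.
by rewrite !mxE mulrA -expr2.
Qed.

Lemma qform_delta n (M : 'M[R]_n) i : qform M (delta_mx i 0) = M i i.
Proof. by rewrite /qform trmx_delta -rowE -colE !mxE. Qed.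

Lemma qform_parallelogram n (M : 'M[R]_n) x y :
  qform M (x + y) + qform M (x - y) = (qform M x + qform M y) *+ 2.
Proof.
rewrite /qform [(x + y)^T]linearD [(x - y)^T]linearB /=.
rewrite mulmxBl mulmxBr !mulmxBl !mulmxDl !mulmxDr.
move: (x^T *m M *m x) (x^T *m M *m y) (y^T *m M *m x) (y^T *m M *m y).
by move=> a b c d; rewrite !mxE; ring.
Qed.

Lemma total_avg n (i j : 'I_n) :
  total (2^-1 *: (delta_mx i 0 + delta_mx j 0) : 'cV[R]_n) = 1.
Proof.
by rewrite totalZ totalD !total_delta -[1 + 1]/(2%:R) mulVf // pnatr_eq0.
Qed.

(** With zero diagonal, the parallelogram identity turns negativity at
    e_i - e_j into positivity at e_i + e_j, so that the midpoint of two basis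
    vectors has total 1 and a positive form. *)
Lemma hollow_unitmx n (M : 'M[R]_n) :
  cond_neg_def M -> (forall i, M i i = 0) -> (1 < n)%N -> M \in unitmx.
Proof.
move=> cM M0 n_gt1; have n_gt0 := ltnW n_gt1.
pose i := Ordinal n_gt0; pose j := Ordinal n_gt1.
apply: (cond_neg_def_unitmx cM (total_avg i j)).
rewrite qformZ mulr_gt0 ?exprn_gt0 ?invr_gt0 ?ltr0n //.
have := qform_parallelogram M (delta_mx i 0) (delta_mx j 0).
rewrite !qform_delta !M0 addr0 mul0rn => /eqP; rewrite addr_eq0 => /eqP->.
rewrite oppr_gt0; apply: cM.2; first by rewrite totalB !total_delta subrr.
rewrite subr_eq0; apply/eqP => /matrixP/(_ i 0); rewrite !mxE !eqxx /=.
by move/eqP; rewrite oner_eq0.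
Qed.

Lemma cof_sumE n (M : 'M[R]_n) : cof_sum M = total (\adj M *m ones n).
Proof.
rewrite /cof_sum /total exchange_big; apply: eq_bigr => i _.
by rewrite mxE; apply: eq_bigr => j _; rewrite !mxE mulr1.
Qed.

(** For invertible M the sum of cofactors is det M * (1^T M^-1 1), so the
    normalizing factor of M^-1 1 is det M / cof M.  The sum 1^T M^-1 1 is both
    the total of z = M^-1 1 and the value z^T M z; it cannot vanish, since a
    vector z of zero total would have z^T M z < 0. *)
Lemma equilibrium_cramer n (M : 'M[R]_n) :
  cond_neg_def M -> M \in unitmx -> ones n != 0 ->
  let u := (\det M / cof_sum M) *: (invmx M *m ones n) in
  total u = 1 /\ M *m u = (\det M / cof_sum M) *: ones n.
Proof.
move=> [MT Mneg] Mu n_gt0 u; split; last by rewrite -scalemxAr mulKVmx.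
set z := invmx M *m ones n.
have detM : \det M != 0 by rewrite -unitfE -unitmxE.
have Mz : M *m z = ones n by rewrite mulKVmx.
have z_neq0 : z != 0.
  by apply: contraNneq n_gt0 => z0; rewrite -Mz z0 mulmx0.
have tz : total z != 0.
  apply/eqP => tz0; have := Mneg z tz0 z_neq0.
  by rewrite /qform -mulmxA Mz tr_mul_ones tz0 mxE mul0rn ltxx.
rewrite totalZ -/z cof_sumE.
have -> : \adj M = \det M *: invmx M.
  by rewrite /invmx Mu scalerA divff // scale1r.
by rewrite -scalemxAl totalZ -/z invfM mulrA divff // mul1r mulVf.
Qed.

End ConditionallyNegativeDefinite.

(** * Negative definiteness of the resistance matrix *)

Section ResistanceForm.
Variables (R : realType) (V E : finType) (G : wgraph R V E).
Local Notation L := (laplacian G).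
Local Notation X := (moore_penrose L).
Local Notation N := (incidence_mx G).
Local Notation nV := #|V|.

Lemma laplacian_sym : L^T = L.
Proof. by rewrite /laplacian !trmx_mul trmxK tr_diag_mx mulmxA. Qed.

Lemma moore_penrose_sym n (A : 'M[R]_n) :
  A^T = A -> (moore_penrose A)^T = moore_penrose A.
Proof.
move=> AT; have [h1 h2 h3 h4] := moore_penroseP A.
apply: (is_moore_penrose_uniq _ (moore_penroseP A)).
have AX : A *m (moore_penrose A)^T = moore_penrose A *m A.
  by rewrite -{1}AT -trmx_mul.
have XA : (moore_penrose A)^T *m A = A *m moore_penrose A.
  by rewrite -{2}AT -trmx_mul.
split.
- by rewrite -mulmxA XA; apply: trmx_inj; rewrite trmx_mul h3 AT h1.
- by rewrite XA; apply: trmx_inj; rewrite trmx_mul !trmxK h3 mulmxA h2.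
- by rewrite AX h4.
- by rewrite XA h3.
Qed.

(** A symmetric matrix commutes with its pseudoinverse, so its range
    projection is also the projection along its kernel. *)
Lemma moore_penrose_residual n (A : 'M[R]_n) (x : 'cV[R]_n) :
  A^T = A -> A *m (x - A *m (moore_penrose A *m x)) = 0.
Proof.
move=> AT; have [h1 _ h3 _] := moore_penroseP A.
have AX : A *m moore_penrose A = moore_penrose A *m A.
  by rewrite -h3 trmx_mul AT moore_penrose_sym.
by rewrite mulmxBr (mulmxA A _ x) AX !mulmxA h1 subrr.
Qed.

Lemma moore_penrose_qform n (A : 'M[R]_n) (x : 'cV[R]_n) :
  A^T = A -> qform (moore_penrose A) x = qform A (moore_penrose A *m x).
Proof.
move=> AT; have [_ h2 _ _] := moore_penroseP A.
by rewrite /qform trmx_mul moore_penrose_sym // -{1}h2 !mulmxA.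
Qed.

Lemma incidence_tr_mulE (z : 'cV[R]_nV) k :
  (N^T *m z) k 0 = z (enum_rank (src G (enum_val k))) 0
                 - z (enum_rank (tgt G (enum_val k))) 0.
Proof.
have pick (v : V) : \sum_i (enum_val i == v)%:R * z i 0 = z (enum_rank v) 0.
  rewrite (bigD1 (enum_rank v)) //= enum_rankK eqxx mul1r big1 ?addr0 // => i.
  by rewrite -(inj_eq enum_val_inj) enum_rankK => /negPf->; rewrite mul0r.
rewrite mxE -!pick -sumrB; apply: eq_bigr => i _.
by rewrite !mxE mulrBl.
Qed.

(** This is where connectedness enters: potentials without edge differences
    are constant. *)
Lemma incidence_kernel (z : 'cV[R]_nV) : N^T *m z = 0 ->
  forall i j, z i 0 = z j 0.
Proof.
move=> Nz i j.
pose a := [pred v : V | z (enum_rank v) 0 == z i 0].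
have edge e : z (enum_rank (src G e)) 0 = z (enum_rank (tgt G e)) 0.
  apply/eqP; rewrite -subr_eq0 -[e]enum_rankK -incidence_tr_mulE Nz mxE.
  exact: eqxx.
have := graph_connected G (enum_val i) (enum_val j).
move/(closed_connect (a := a)); rewrite !inE !enum_valK eqxx => h.
apply/esym/eqP; rewrite -h // => u v /= /existsP[e].
by case/orP => /andP[/eqP<- /eqP<-]; rewrite !inE edge.
Qed.

Lemma laplacian_qform (z : 'cV[R]_nV) :
  qform L z = \sum_k cond G (enum_val k) * (N^T *m z) k 0 ^+ 2.
Proof.
rewrite /qform /laplacian /cond_mx.
have -> : z^T *m (N *m diag_mx (\row_k cond G (enum_val k)) *m N^T) *m z
  = (N^T *m z)^T *m (diag_mx (\row_k cond G (enum_val k)) *m (N^T *m z)).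
  by rewrite trmx_mul trmxK !mulmxA.
move: (N^T *m z) => y; rewrite mxE; apply: eq_bigr => k _.
by rewrite mul_diag_mx !mxE mulrCA -expr2.
Qed.

Lemma laplacian_qform_ge0 (z : 'cV[R]_nV) : 0 <= qform L z.
Proof.
rewrite laplacian_qform; apply: sumr_ge0 => k _.
by rewrite mulr_ge0 ?sqr_ge0 // ltW // cond_gt0.
Qed.

Lemma laplacian_qform_eq0 (z : 'cV[R]_nV) :
  qform L z = 0 -> N^T *m z = 0.
Proof.
rewrite laplacian_qform => /eqP; rewrite psumr_eq0; last first.
  by move=> k _; rewrite mulr_ge0 ?sqr_ge0 // ltW // cond_gt0.
move/allP => h; apply/matrixP => k j; rewrite ord1 [RHS]mxE.
have := h k (mem_index_enum k).
by rewrite mulf_eq0 gt_eqF ?cond_gt0 //= sqrf_eq0 => /eqP.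
Qed.

Lemma mul_laplacian_ones : L *m ones R nV = 0.
Proof.
suff -> : L *m ones R nV = N *m cond_mx G *m (N^T *m ones R nV).
  suff -> : N^T *m ones R nV = 0 by rewrite mulmx0.
  by apply/matrixP => k j; rewrite ord1 incidence_tr_mulE !mxE subrr.
by rewrite /laplacian !mulmxA.
Qed.

Lemma total_laplacian (z : 'cV[R]_nV) : total (L *m z) = 0.
Proof.
have := ones_tr_mul (L *m z).
rewrite mulmxA -{1}laplacian_sym -trmx_mul mul_laplacian_ones trmx0 mul0mx.
by move/matrixP/(_ 0 0); rewrite !mxE eqxx.
Qed.

(** The residual x - L L^+ x lies in the kernel of L, hence is constant, and
    its total is zero. *)
Lemma laplacian_moore_penroseK (x : 'cV[R]_nV) :
  total x = 0 -> L *m (X *m x) = x.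
Proof.
move=> x0; set y := x - L *m (X *m x).
have Ly : L *m y = 0 := moore_penrose_residual x laplacian_sym.
have y0 : total y = 0 by rewrite totalB x0 total_laplacian subr0.
have yc := incidence_kernel (laplacian_qform_eq0 (z := y) _).
have {}yc := yc ltac:(by rewrite /qform -mulmxA Ly mulmx0 mxE).
suff /eqP : y = 0 by rewrite subr_eq0 => /eqP.
apply/matrixP => i j; rewrite ord1 [RHS]mxE; apply/eqP.
have : total y = y i 0 *+ nV.
  by rewrite /total (eq_bigr (fun=> y i 0)) ?sumr_const ?card_ord // => k _.
move/eqP; rewrite y0 eq_sym mulrn_eq0 => /orP[/eqP n0|//].
by have := ltn_ord i; rewrite {2}n0.
Qed.

Lemma moore_penrose_qform_gt0 (x : 'cV[R]_nV) :
  total x = 0 -> x != 0 -> 0 < qform X x.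
Proof.
move=> x0 x_neq0.
rewrite lt_neqAle (moore_penrose_qform _ laplacian_sym).
rewrite laplacian_qform_ge0 andbT eq_sym.
apply: contraNneq x_neq0 => /laplacian_qform_eq0 NXx.
by rewrite -(laplacian_moore_penroseK x0) {1}/laplacian -!mulmxA NXx !mulmx0.
Qed.

Definition full_res_mx : 'M[R]_nV :=
  \matrix_(i, j) eff_res G (enum_val i) (enum_val j).

Lemma eff_resE (i j : 'I_nV) :
  eff_res G (enum_val i) (enum_val j) = X i i + X j j - (X i j + X j i).
Proof.
rewrite /eff_res /basis_vec !enum_valK; move: X => Y.
rewrite [(_ - _)^T]linearB /= !trmx_delta.
by rewrite mulmxBl -!rowE mulmxBr -!colE !mxE; ring.
Qed.

Lemma full_res_mxE :
  let d := \col_i X i i in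
  full_res_mx = d *m (ones R nV)^T + ones R nV *m d^T - X *+ 2.
Proof.
move=> d; apply/matrixP => i j; rewrite mxE eff_resE.
have XT : X j i = X i j.
  by rewrite -{1}(moore_penrose_sym laplacian_sym) mxE.
by rewrite XT mulr2n !mxE !big_ord1 !mxE mulr1 mul1r.
Qed.

Lemma full_res_mx_cond_neg_def : cond_neg_def full_res_mx.
Proof.
have XT := moore_penrose_sym laplacian_sym.
split.
  rewrite full_res_mxE linearB linearD /= !trmx_mul !trmxK mulr2n linearD /=.
  by rewrite XT [X in X - _]addrC.
move=> x x0 x_neq0; have := moore_penrose_qform_gt0 x0 x_neq0.
suff -> : qform full_res_mx x = - (qform X x *+ 2).
  by move=> h; rewrite oppr_lt0 pmulrn_lgt0.
rewrite /qform full_res_mxE mulmxBr mulmxBl mulmxDr mulmxDl.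
rewrite !mulmxA tr_mul_ones x0 -!(mulmxA _ _ x) ones_tr_mul x0.
rewrite raddf0 mulmx0 !mul0mx addr0 add0r [X *+ 2]mulr2n mulmxDl mulmxDr.
by rewrite mulr2n mxE [in LHS]mxE.
Qed.

(** * Restriction and extension by zero *)

(** Multiplication by this matrix extends a vector on S by zero to V, and
    multiplication by its transpose restricts a vector on V to S. *)
Definition embed_mx (S : {set V}) : 'M[R]_(nV, #|S|) :=
  \matrix_(k, i) (enum_val k == enum_val i)%:R.

Lemma embed_tr_mulE (S : {set V}) n (M : 'M[R]_(nV, n)) i j :
  ((embed_mx S)^T *m M) i j = M (enum_rank (enum_val i)) j.
Proof.
rewrite mxE (bigD1 (enum_rank (enum_val i))) //= !mxE enum_rankK eqxx mul1r.
rewrite big1 ?addr0 // => k; rewrite !mxE.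
by rewrite -(inj_eq enum_val_inj) enum_rankK => /negPf->; rewrite mul0r.
Qed.

Lemma embed_mxK (S : {set V}) : (embed_mx S)^T *m embed_mx S = 1%:M.
Proof.
apply/matrixP => i j.
by rewrite embed_tr_mulE !mxE enum_rankK (inj_eq enum_val_inj).
Qed.

Lemma total_embed (S : {set V}) (x : 'cV[R]_#|S|) :
  total (embed_mx S *m x) = total x.
Proof.
have J1 : (embed_mx S)^T *m ones R nV = ones R #|S|.
  by apply/matrixP => i j; rewrite embed_tr_mulE !mxE.
have := tr_mul_ones (embed_mx S *m x).
rewrite trmx_mul -mulmxA J1 tr_mul_ones.
by move/matrixP/(_ 0 0); rewrite !mxE eqxx !mulr1n.
Qed.

Lemma res_mxE (S : {set V}) :
  res_mx G S = (embed_mx S)^T *m full_res_mx *m embed_mx S.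
Proof.
apply/matrixP => i j; rewrite -mulmxA embed_tr_mulE !mxE.
rewrite (bigD1 (enum_rank (enum_val j))) //= !mxE !enum_rankK eqxx mulr1.
rewrite big1 ?addr0 // => k; rewrite !mxE.
by rewrite -(inj_eq enum_val_inj) enum_rankK => /negPf->; rewrite mulr0.
Qed.

Lemma res_qform (S : {set V}) x :
  qform (res_mx G S) x = qform full_res_mx (embed_mx S *m x).
Proof. by rewrite /qform res_mxE trmx_mul !mulmxA. Qed.

Lemma res_mx_cond_neg_def (S : {set V}) : cond_neg_def (res_mx G S).
Proof.
have [RT Rneg] := full_res_mx_cond_neg_def; split.
  by rewrite res_mxE !trmx_mul trmxK RT mulmxA.
move=> x x0 x_neq0; rewrite res_qform; apply: Rneg; rewrite ?total_embed //.
apply: contraNneq x_neq0 => Jx.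
by rewrite -[x]mul1mx -embed_mxK -mulmxA Jx mulmx0.
Qed.

Lemma eff_res_diag v : eff_res G v v = 0.
Proof. by rewrite /eff_res subrr mulmx0 mxE. Qed.

Lemma embed_mul_in (S : {set V}) (x : 'cV[R]_#|S|) v (vS : v \in S) :
  (embed_mx S *m x) (enum_rank v) 0 = x (enum_rank_in vS v) 0.
Proof.
rewrite mxE (bigD1 (enum_rank_in vS v)) //= !mxE enum_rankK enum_rankK_in //.
rewrite eqxx mul1r big1 ?addr0 // => k; rewrite !mxE enum_rankK.
rewrite -(inj_eq enum_val_inj) enum_rankK_in // eq_sym => /negPf->.
by rewrite mul0r.
Qed.

Lemma embed_mul_notin (S : {set V}) (x : 'cV[R]_#|S|) v :
  v \notin S -> (embed_mx S *m x) (enum_rank v) 0 = 0.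
Proof.
move=> vS; rewrite mxE big1 // => k _; rewrite mxE enum_rankK.
case: eqP => [vk|_]; last by rewrite mul0r.
by rewrite vk enum_valP in vS.
Qed.

Definition supported_in (S : {set V}) (z : 'cV[R]_nV) : Prop :=
  forall v, v \notin S -> z (enum_rank v) 0 = 0.

Lemma supported_embed (S T : {set V}) (x : 'cV[R]_#|S|) :
  S \subset T -> supported_in T (embed_mx S *m x).
Proof.
move=> sST v vT; rewrite embed_mul_notin //.
by apply: contra vT => /(subsetP sST).
Qed.

Lemma embed_restrictK (S : {set V}) (z : 'cV[R]_nV) :
  supported_in S z -> embed_mx S *m ((embed_mx S)^T *m z) = z.
Proof.
move=> zS; apply/matrixP => k j; rewrite ord1 -(enum_valK k).
have [kS|kS] := boolP (enum_val k \in S); last by rewrite embed_mul_notin ?zS.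
by rewrite embed_mul_in embed_tr_mulE enum_rankK_in.
Qed.

(** An equilibrium on S, extended by zero, still behaves as one when tested
    against vectors supported in S. *)
Lemma embed_equilibrium (S : {set V}) u r (z : 'cV[R]_nV) :
  res_mx G S *m u = r *: ones R #|S| -> supported_in S z ->
  z^T *m full_res_mx *m (embed_mx S *m u) = (r * total z)%:M.
Proof.
move=> Su zS; rewrite -(embed_restrictK zS) total_embed.
by rewrite -(tr_mul_equilibrium _ Su) res_mxE trmx_mul !mulmxA.
Qed.

(** * The optimal vector and the theorem *)

(** If S has at least two elements, R[S] is invertible and the equilibrium from
    Cramer's rule is the unique maximizer.  For a singleton R[S] = (0), so the
    vector 1 is an equilibrium of level 0 = rho(S); thus both cases can be
    treated alike afterwards. *)
Lemma opt_vec_equilibrium (S : {set V}) : S != set0 ->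
  total (opt_vec G S) = 1 /\
  res_mx G S *m opt_vec G S = rho G S *: ones R #|S|.
Proof.
rewrite -card_gt0 => S_gt0; have cR := res_mx_cond_neg_def S.
have diag i : res_mx G S i i = 0 by rewrite mxE eff_res_diag.
rewrite /opt_vec; case: leqP => [S_le1|S_gt1]; last first.
  have uR := hollow_unitmx cR diag S_gt1.
  have ones_neq0 : ones R #|S| != 0.
    apply/eqP => /matrixP/(_ (Ordinal S_gt0) 0) /eqP.
    by rewrite !mxE oner_eq0.
  have [] := equilibrium_cramer cR uR ones_neq0.
  set u := _ *: _; rewrite -/(rho G S) => u1 Ru.
  have qu : qform (res_mx G S) u = rho G S.
    by apply/eqP; rewrite (qform_le_equilibrium cR Ru u1 u1).
  have max_u : is_maximizer G u.
    split=> // w w1; rewrite -![quad_form _ _]/(qform _ _) qu.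
    exact: (qform_le_equilibrium cR Ru u1 w1).
  have [w1 max_w] := classical_sets.xgetPex 0 (ex_intro _ u max_u).
  set w := classical_sets.xget _ _ in w1 max_w *.
  suff /eqP -> : w == u by [].
  have wu := qform_le_equilibrium cR Ru u1 w1.
  rewrite -wu.2 eq_le wu.1 /= -qu; exact: max_w.
have S1 : #|S| = 1%N by apply/eqP; rewrite eqn_leq S_le1.
have R0 : res_mx G S = 0.
  apply/matrixP => i j; have -> : i = j; last by rewrite diag mxE.
  have lt0 (k : 'I_#|S|) : nat_of_ord k = 0%N.
    by have := ltn_ord k; rewrite {2}S1; case: (nat_of_ord k).
  by apply: val_inj; rewrite /= !lt0.
rewrite /rho R0 mul0mx; split.
  rewrite /total (eq_bigr (fun=> 1)) => [|i _]; last by rewrite mxE.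
  by rewrite sumr_const card_ord S1.
suff -> : \det (0 : 'M[R]_#|S|) = 0 by rewrite mul0r scale0r.
by case: #|S| S_gt0 => // n _; rewrite det0.
Qed.

End ResistanceForm.

Theorem theorem4p3 (R : realType) (V E : finType) (G : wgraph R V E)
    (A B : {set V}) (A_neq0 : A != set0) (sAB : A \subset B) :
  rho G A = rho G B <->
  (forall (v : V) (vB : v \in B), v \notin A ->
     opt_vec G B (enum_rank_in vB v) 0 = 0).
Proof.
have B_neq0 : B != set0 by apply: contraNneq A_neq0 => B0; rewrite -subset0 -B0.
have [uA1 RuA] := opt_vec_equilibrium G A_neq0.
have [uB1 RuB] := opt_vec_equilibrium G B_neq0.
set uA := opt_vec G A in uA1 RuA *; set uB := opt_vec G B in uB1 RuB *.
pose yA := embed_mx R A *m uA; pose yB := embed_mx R B *m uB.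
have yA_B : supported_in B yA by exact: supported_embed.
have cB := res_mx_cond_neg_def G B.
split=> [rhoAB v vB vA|uB0].
  (* The restriction to B of the extension of u_A attains the maximum on B. *)
  pose x := (embed_mx R B)^T *m yA.
  have Jx : embed_mx R B *m x = yA by exact: embed_restrictK.
  have x1 : total x = 1 by rewrite -total_embed Jx total_embed.
  have qx : qform (res_mx G B) x == rho G B.
    rewrite res_qform Jx -res_qform -rhoAB.
    by rewrite (qform_le_equilibrium (res_mx_cond_neg_def G A) RuA uA1 uA1).
  rewrite (qform_le_equilibrium cB RuB uB1 x1) in qx.
  by rewrite -(eqP qx) -embed_mul_in Jx embed_mul_notin.
have yB_A : supported_in A yB.
  move=> v vA; have [vB|vB] := boolP (v \in B); last exact: embed_mul_notin.
  by rewrite embed_mul_in uB0.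
(* Evaluate yA^T R yB with each of the two equilibrium equations. *)
have := embed_equilibrium RuA yB_A.
rewrite total_embed uB1 mulr1 => /(congr1 trmx).
rewrite (tr_bilinear _ _ (full_res_mx_cond_neg_def G).1).
rewrite (embed_equilibrium RuB yA_B) total_embed uA1 mulr1 tr_scalar_mx.
by move/matrixP/(_ 0 0); rewrite !mxE eqxx !mulr1n.
Qed.
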